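(* $$\frac{1}{1-\log(2)}=\mathrm{CF}\left[3n^2+7n+4,\,-2n^2(n+1)^2\right].$$
   Context: For sequences $(a_n)_{n\ge0}$, $(b_n)_{n\ge1}$, $\mathrm{CF}[a_n,b_n]$ denotes the continued fraction $a_0+\cfrac{b_1}{a_1+\cfrac{b_2}{a_2+\ddots}}$, whose value is $\lim_{n\to\infty}A_n/B_n$, where $A_0=1$, $A_1=a_0$, $B_0=0$, $B_1=1$, and $A_{n+1}=a_nA_n+b_nA_{n-1}$, $B_{n+1}=a_nB_n+b_nB_{n-1}$ for $n\ge1$. $\log$ is the natural logarithm. *)

(* Defs.v *)
(* Stdlib reals with Coquelicot limits. *)
From Stdlib Require Import Reals.
From Coquelicot Require Import Coquelicot.
Open Scope R_scope.

(* Index convention: cf_num a b 0 = 1 and cf_num a b 1 = a 0, so that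
   cf_num a b n / cf_den a b n is the truncation ending with a (n - 1).
   The value b 0 is never used. *)
Fixpoint cf_num (a b : nat -> R) (n : nat) : R :=
  match n with
  | O => 1
  | S m => match m with
           | O => a O
           | S k => a m * cf_num a b m + b m * cf_num a b k
           end
  end.

Fixpoint cf_den (a b : nat -> R) (n : nat) : R :=
  match n with
  | O => 0
  | S m => match m with
           | O => 1
           | S k => a m * cf_den a b m + b m * cf_den a b k
           end
  end.

(* Division is total on R, so the requirement that the convergents be
   well defined from some index on is made explicit. *)
Definition is_CF (a b : nat -> R) (l : R) : Prop :=
  eventually (fun n => cf_den a b n <> 0) /\
  is_lim_seq (fun n => cf_num a b n / cf_den a b n) (Finite l).

(* Main.v *)
(* The numerators are A_n = 2^n n! (n+1)!.  The determinant recurrence then gives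
   B_n / A_n = sum_(k=1..n) 2^(-k) / (k (k+1)), which partial fractions turn into
   1 - T_n - 2^(-n) / (n+1) with T_n = sum_(k=1..n) 2^(-k) / k.  Finally T_n tends to
   -ln (1 - 1/2) = ln 2. *)
Require Import Defs.
From Stdlib Require Import Reals Factorial Lra Lia.
From Coquelicot Require Import Coquelicot.
Open Scope R_scope.

Definition log_sum (n : nat) (x : R) : R :=
  sum_f_R0 (fun k => x ^ S k / INR (S k)) n.

(** Differentiating [log_sum n] termwise gives the geometric sum 1 + x + ... + x^n = (1 - x^(n+1)) /
    (1 - x), against 1 / (1 - x) from the logarithm. The induction removes one power at a time. *)
Lemma is_derive_log_remainder (n : nat) (x : R) :
  x < 1 ->
  is_derive (fun t => - ln (1 - t) - log_sum n t) x (x ^ S n / (1 - x)).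
Proof.
intros Hx; induction n as [|n IH].
- unfold log_sum; simpl.
  auto_derive; [lra | field; lra].
- assert (Hext : forall t, - ln (1 - t) - log_sum n t - t ^ S (S n) / INR (S (S n)) =
                            - ln (1 - t) - log_sum (S n) t).
  { intros t; unfold log_sum; rewrite (tech5 _ n); ring. }
  apply (is_derive_ext _ _ _ _ Hext).
  replace (x ^ S (S n) / (1 - x)) with (x ^ S n / (1 - x) - x ^ S n)
    by (simpl; field; lra).
  apply (is_derive_minus (V := R_NormedModule)); [exact IH|].
  assert (HN : INR (S (S n)) <> 0) by (apply not_0_INR; lia).
  auto_derive; [exact I|].
  fold (INR (S n)); fold (INR (S (S n))); simpl pow; field; exact HN.
Qed.

(** Mean value theorem for the remainder, which vanishes at 0: the bound 1 / (1 - c) <= 2 for c <=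
    1/2 is offset by the interval length 1/2. *)
Lemma log_sum_half_bounds (n : nat) :
  Rabs (log_sum n (1 / 2) - ln 2) <= (1 / 2) ^ S n.
Proof.
set (f := fun t => - ln (1 - t) - log_sum n t).
destruct (MVT_gen f 0 (1 / 2) (fun x => x ^ S n / (1 - x))) as [c [Hc Heq]].
- rewrite Rmin_left, Rmax_right by lra.
  intros x Hx; apply is_derive_log_remainder; lra.
- rewrite Rmin_left, Rmax_right by lra.
  intros x Hx; apply continuity_pt_filterlim, (ex_derive_continuous (V := R_NormedModule)).
  eexists; apply is_derive_log_remainder; lra.
- rewrite Rmin_left, Rmax_right in Hc by lra.
  assert (H0 : f 0 = 0).
  { unfold f; rewrite Rminus_0_r, ln_1.
    assert (H : log_sum n 0 = 0).
    { unfold log_sum; apply sum_eq_R0; intros k _.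
      rewrite pow_i by lia; unfold Rdiv; ring. }
    rewrite H; ring. }
  assert (H1 : f (1 / 2) = ln 2 - log_sum n (1 / 2)).
  { unfold f; replace (1 - 1 / 2) with (/ 2) by lra.
    rewrite ln_Rinv by lra; ring. }
  rewrite H0, H1 in Heq.
  assert (Hpow : 0 <= c ^ S n <= (1 / 2) ^ S n).
  { split; [apply pow_le; lra | apply pow_incr; lra]. }
  assert (Hinv : 0 < / (1 - c) <= 2).
  { split; [apply Rinv_0_lt_compat; lra|].
    rewrite <- (Rinv_inv 2); apply Rinv_le_contravar; lra. }
  unfold Rdiv at 3 in Heq.
  apply Rabs_le; nra.
Qed.

Lemma is_lim_seq_half_pow : is_lim_seq (fun n => (1 / 2) ^ S n) 0.
Proof.
apply (is_lim_seq_incr_1 (fun n => (1 / 2) ^ n)), is_lim_seq_geom.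
rewrite Rabs_pos_eq; lra.
Qed.

Lemma is_lim_seq_log_sum_half : is_lim_seq (fun n => log_sum n (1 / 2)) (ln 2).
Proof.
apply is_lim_seq_le_le with
  (fun n => ln 2 - (1 / 2) ^ S n) (fun n => ln 2 + (1 / 2) ^ S n).
- intros n; pose proof (log_sum_half_bounds n) as H.
  apply Rabs_le_between in H; lra.
- replace (Finite (ln 2)) with (Finite (ln 2 - 0)) by (f_equal; ring).
  apply is_lim_seq_minus'; [apply is_lim_seq_const | apply is_lim_seq_half_pow].
- replace (Finite (ln 2)) with (Finite (ln 2 + 0)) by (f_equal; ring).
  apply is_lim_seq_plus'; [apply is_lim_seq_const | apply is_lim_seq_half_pow].
Qed.

Definition log2_partial_num (n : nat) : R := 3 * INR n ^ 2 + 7 * INR n + 4.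
Definition log2_partial_den (n : nat) : R := - 2 * INR n ^ 2 * (INR n + 1) ^ 2.

Local Notation a := log2_partial_num.
Local Notation b := log2_partial_den.

(** Closed form of B_(n+1) / A_(n+1). The index is shifted because [log_sum n] has n + 1 terms, so
    it is T_(n+1). *)
Definition convergent_inv (n : nat) : R :=
  1 - log_sum n (1 / 2) - (1 / 2) ^ S n / (INR n + 2).

(** The ratios A_(m+1) / A_m = 2(m+1)(m+2) fit the recurrence because 3m^2 + 7m + 4 = 2(m+1)(m+2) +
    m(m+1). The recurrence has order two, so the induction carries two consecutive indices. *)
Lemma cf_num_log2 (n : nat) :
  cf_num a b n = 2 ^ n * INR (fact n) * INR (fact (S n)).
Proof.
enough (H : cf_num a b n = 2 ^ n * INR (fact n) * INR (fact (S n)) /\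
            cf_num a b (S n) = 2 ^ S n * INR (fact (S n)) * INR (fact (S (S n))))
  by apply H.
induction n as [|n [IH0 IH1]].
- unfold log2_partial_num; simpl; split; ring.
- split; [exact IH1|].
  change (cf_num a b (S (S n))) with
    (a (S n) * cf_num a b (S n) + b (S n) * cf_num a b n).
  rewrite IH0, IH1; unfold log2_partial_num, log2_partial_den.
  rewrite !fact_simpl, !mult_INR, !S_INR; simpl; ring.
Qed.

Lemma cf_num_log2_neq_0 (n : nat) : cf_num a b n <> 0.
Proof.
rewrite cf_num_log2.
repeat apply Rmult_integral_contrapositive_currified;
  [apply pow_nonzero; lra | apply INR_fact_neq_0 | apply INR_fact_neq_0].
Qed.

(** The closed form is checked directly against the recurrence. Once [tech5] reduces all sums to the
    one up to n, its coefficient cancels by the recurrence of the numerators, and a rational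
    identity remains. *)
Lemma cf_den_log2 (n : nat) :
  cf_den a b (S n) = cf_num a b (S n) * convergent_inv n.
Proof.
enough (H : cf_den a b (S n) = cf_num a b (S n) * convergent_inv n /\
            cf_den a b (S (S n)) = cf_num a b (S (S n)) * convergent_inv (S n))
  by apply H.
induction n as [|n [IH0 IH1]].
- unfold convergent_inv, log_sum, log2_partial_num, log2_partial_den; simpl.
  split; field.
- split; [exact IH1|].
  change (cf_den a b (S (S (S n)))) with
    (a (S (S n)) * cf_den a b (S (S n)) + b (S (S n)) * cf_den a b (S n)).
  rewrite IH0, IH1, !cf_num_log2.
  unfold convergent_inv, log_sum, log2_partial_num, log2_partial_den.
  rewrite !tech5, !fact_simpl, !mult_INR, !S_INR.
  pose proof (pos_INR n) as Hn.
  replace (2 ^ S n) with (2 * 2 ^ n) by reflexivity.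
  simpl pow; field; lra.
Qed.

Lemma is_lim_seq_convergent_inv : is_lim_seq convergent_inv (1 - ln 2).
Proof.
replace (Finite (1 - ln 2)) with (Finite (1 - ln 2 - 0)) by (f_equal; ring).
apply is_lim_seq_minus'.
- apply is_lim_seq_minus'; [apply is_lim_seq_const | apply is_lim_seq_log_sum_half].
- apply is_lim_seq_le_le with (fun _ => 0) (fun n => (1 / 2) ^ S n).
  + intros n; pose proof (pos_INR n) as Hn.
    assert (Hp : 0 < (1 / 2) ^ S n) by (apply pow_lt; lra).
    split.
    * apply Rlt_le, Rdiv_lt_0_compat; lra.
    * apply Rle_div_l; nra.
  + apply is_lim_seq_const.
  + apply is_lim_seq_half_pow.
Qed.

(** Ensures a nonzero limit of [convergent_inv]; it comes from 1 + 1 < exp 1. *)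
Lemma ln_2_lt_1 : ln 2 < 1.
Proof.
rewrite <- (ln_exp 1); apply ln_increasing; [lra|].
pose proof (exp_ineq1 1); lra.
Qed.

Theorem corollary2p31 :
  is_CF (fun n => 3 * INR n ^ 2 + 7 * INR n + 4)
        (fun n => - 2 * INR n ^ 2 * (INR n + 1) ^ 2)
        (1 / (1 - ln 2)).
Proof.
change (is_CF a b (1 / (1 - ln 2))).
pose proof ln_2_lt_1 as Hln.
assert (Hpos : eventually (fun n => convergent_inv n <> 0)).
{ assert (He : 0 < 1 - ln 2) by lra.
  (* The tolerance is the limit 1 - ln 2 itself: a zero term would lie at exactly that distance. *)
  pose proof (proj2 (is_lim_seq_spec _ _) is_lim_seq_convergent_inv
                (mkposreal _ He)) as [N HN].
  exists N; intros n Hn H0.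
  specialize (HN n Hn); simpl in HN.
  apply Rabs_def2 in HN; lra. }
split.
- destruct Hpos as [N HN].
  (* Index 0 must be excluded since B_0 = 0. *)
  exists (S N); intros [|n] Hn; [lia|].
  rewrite cf_den_log2.
  apply Rmult_integral_contrapositive_currified;
    [apply cf_num_log2_neq_0 | apply HN; lia].
(* After the shift, the factor A_(n+1) cancels from each convergent. *)
- apply is_lim_seq_incr_1.
  apply is_lim_seq_ext_loc with (fun n => 1 / convergent_inv n).
  + destruct Hpos as [N HN].
    exists N; intros n Hn.
    rewrite cf_den_log2; field.
    split; [exact (HN n Hn) | apply cf_num_log2_neq_0].
  + apply is_lim_seq_div';
      [apply is_lim_seq_const | apply is_lim_seq_convergent_inv | lra].
Qed.
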